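(* Let $G$ be a finitely presented group with $n:=b_1(G,\mathbb{Q})>0$, and let $\Bbbk$ be a field of characteristic $p$. Set $n_p:=b_1(G,\Bbbk)$. Suppose that the Alexander ideal $\mathcal{E}_1(A_G)$ is almost principal over $\Bbbk$, i.e., for some integer $d\ge0$, $$I^d\cdot(\Delta^G)\subseteq\mathcal{E}_1(A_G)\quad\text{in }\Bbbk G_{\rm abf},$$ and that $n_p>d+1$. Then $\Delta^G\in\mathfrak{m}^{\,n_p-d-1}$, where $\mathfrak{m}$ is the maximal ideal of $\Bbbk[[x_1,\dots,x_n]]$ and $\Delta^G$ is viewed in $\Bbbk[[x_1,\dots,x_n]]$ by Magnus expansion. In particular, $\Delta^G(1)=0\in\Bbbk$.
   Context: For a finitely generated group $G$, let $G_{\rm abf}$ be the quotient of $G/G'$ by its torsion subgroup; $G_{\rm abf}\cong\mathbb{Z}^n$ with $n=b_1(G,\mathbb{Q})=\dim_{\mathbb{Q}}H_1(G,\mathbb{Q})$, and $\mathbb{Z}[G_{\rm abf}]$ is identified with $\Lambda=\mathbb{Z}[t_1^{\pm1},\dots,t_n^{\pm1}]$. Also $b_1(G,\Bbbk)=\dim_{\Bbbk}H_1(G,\Bbbk)$. Let $M$ be a connected CW-complex with finite $1$-skeleton, basepoint $m_0$ and $\pi_1(M,m_0)=G$, and $p:X\to M$ the Galois cover corresponding to the kernel of $G\to G_{\rm abf}$. The Alexander module is the finitely presented $\Lambda$-module $A_G=H_1(X,p^{-1}(m_0);\mathbb{Z})$; it depends only on $G$ (equivalently, $A_G\cong\Lambda\otimes_{\mathbb{Z}G}I_G$,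 with $I_G$ the augmentation ideal of $\mathbb{Z}G$). If $A_G=\operatorname{coker}(\Lambda^s\to\Lambda^m)$, then $\mathcal{E}_1(A_G)\subseteq\Lambda$ is the ideal generated by the minors of size $m-1$ of the presentation matrix (independent of the presentation; minors of size $\le0$ equal $1$, and minors exceeding the matrix size are $0$). The Alexander polynomial $\Delta^G\in\Lambda$ is the greatest common divisor of the elements of $\mathcal{E}_1(A_G)$, defined up to units of $\Lambda$. In the almost principal condition, $I$ is the augmentation ideal of $\Bbbk G_{\rm abf}$, and $(\Delta^G)$ and $\mathcal{E}_1(A_G)$ denote the ideals of $\Bbbk G_{\rm abf}$ generated by the images of $\Delta^G$ and $\mathcal{E}_1(A_G)$. The Magnus expansion is the ring homomorphism $e:\Lambda\to\Bbbk[[x_1,\dots,x_n]]$ with $e(t_i)=1+x_i$; $\mathfrak{m}=(x_1,\dots,x_n)$. $\Delta^G(1)$ is the value at $t_1=\dots=t_n=1$, reduced to $\Bbbk$. *)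

(* Defs.v *)
From HB Require Import structures.
From mathcomp Require Import all_boot all_algebra generic_quotient ring_quotient.
From mathcomp.classical Require Import boolp classical_sets.
From mathcomp.finmap Require Import finmap.
From mathcomp.multinomials Require Import mpoly.

Set Implicit Arguments.
Unset Strict Implicit.
Unset Printing Implicit Defensive.

Import GRing.Theory.

Local Open Scope ring_scope.
Local Open Scope classical_set_scope.

Record pseries (n : nat) (R : nzRingType) :=
  PSeries { ps_coef : 'X_{1.. n} -> R }.

Section PSeriesRing.
Variables (n : nat) (R : comNzRingType).
Local Notation ps := (pseries n R).
Implicit Types f g h : ps.

Lemma psP f g : (forall m, ps_coef f m = ps_coef g m) -> f = g.
Proof. by case: f g => [f] [g] /= /funext ->. Qed.

HB.instance Definition _ := gen_eqMixin ps.
HB.instance Definition _ := gen_choiceMixin ps.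

Definition ps_zero : ps := PSeries (fun=> 0).
Definition ps_opp f : ps := PSeries (fun m => - ps_coef f m).
Definition ps_add f g : ps := PSeries (fun m => ps_coef f m + ps_coef g m).
Definition ps_one : ps := PSeries (fun m => (m == 0%MM)%:R).
(* Cauchy product: the sum runs over all pairs of exponents of sum m. *)
Definition ps_mul f g : ps := PSeries (fun m =>
  \sum_(k : 'X_{1.. n < (mdeg m).+1, (mdeg m).+1} | m == (k.1 + k.2)%MM)
    ps_coef f k.1 * ps_coef g k.2).

Fact ps_addA : associative ps_add.
Proof. by move=> f g h; apply: psP => m /=; rewrite addrA. Qed.
Fact ps_addC : commutative ps_add.
Proof. by move=> f g; apply: psP => m /=; rewrite addrC. Qed.
Fact ps_add0 : left_id ps_zero ps_add.
Proof. by move=> f; apply: psP => m /=; rewrite add0r. Qed.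
Fact ps_addN : left_inverse ps_zero ps_opp ps_add.
Proof. by move=> f; apply: psP => m /=; rewrite addNr. Qed.

HB.instance Definition _ :=
  GRing.isZmodule.Build ps ps_addA ps_addC ps_add0 ps_addN.

(* The polynomial part of degree < b: the ring laws of power series are
   transferred from those of multivariate polynomials. *)
Definition ps_trunc (b : nat) f : {mpoly R[n]} :=
  \sum_(k : 'X_{1.. n < b}) ps_coef f k *: 'X_[k].

Lemma ps_truncE b f m :
  (ps_trunc b f)@_m = if (mdeg m < b)%N then ps_coef f m else 0.
Proof.
rewrite /ps_trunc raddf_sum /=; case: ifP => hm.
  rewrite (bigD1 (BMultinom hm)) //= mcoeffZ mcoeffX eqxx mulr1.
  rewrite big1 ?addr0 // => k /eqP ne; rewrite mcoeffZ mcoeffX.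
  by case: eqP => [E|_]; rewrite ?mulr0 //; case: ne; apply: val_inj.
rewrite big1 // => k _; rewrite mcoeffZ mcoeffX.
by case: eqP => [E|_]; rewrite ?mulr0 //; rewrite -E bmdeg in hm.
Qed.

Lemma ps_mulE b f g m : (mdeg m < b)%N ->
  ps_coef (ps_mul f g) m = (ps_trunc b f * ps_trunc b g)@_m.
Proof.
move=> hm; rewrite mcoeffM /=; apply: eq_bigr => -[k1 k2] /= /eqP mE.
have /andP[h1 h2] : (mdeg k1 < b)%N && (mdeg k2 < b)%N.
  have dE : mdeg m = (mdeg k1 + mdeg k2)%N by rewrite -mdegD -mE.
  by rewrite !(leq_ltn_trans _ hm) // [X in (_ <= X)%N]dE ?leq_addl ?leq_addr.
by rewrite !ps_truncE h1 h2.
Qed.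

Lemma eq_mcoeffM (p p' q q' : {mpoly R[n]}) m :
  (forall k, (mdeg k <= mdeg m)%N -> p@_k = p'@_k) ->
  (forall k, (mdeg k <= mdeg m)%N -> q@_k = q'@_k) ->
  (p * q)@_m = (p' * q')@_m.
Proof.
move=> hp hq; rewrite !mcoeffM; apply: eq_bigr => -[k1 k2] /= /eqP mE.
have dE : mdeg m = (mdeg k1 + mdeg k2)%N by rewrite -mdegD -mE.
by rewrite hp ?hq // [X in (_ <= X)%N]dE ?leq_addl ?leq_addr.
Qed.

Fact ps_mulA : associative ps_mul.
Proof.
move=> f g h; apply: psP => m; have hm := ltnSn (mdeg m).
rewrite !(ps_mulE _ _ hm).
transitivity ((ps_trunc (mdeg m).+1 f *
   (ps_trunc (mdeg m).+1 g * ps_trunc (mdeg m).+1 h))@_m).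
  apply: eq_mcoeffM => // k hk; rewrite ps_truncE ltnS hk.
  by rewrite (@ps_mulE (mdeg m).+1).
rewrite mulrA; apply: eq_mcoeffM => // k hk; rewrite ps_truncE ltnS hk.
by rewrite (@ps_mulE (mdeg m).+1).
Qed.

Fact ps_mulC : commutative ps_mul.
Proof.
move=> f g; apply: psP => m; have hm := ltnSn (mdeg m).
by rewrite !(ps_mulE _ _ hm) mulrC.
Qed.

Fact ps_mul1 : left_id ps_one ps_mul.
Proof.
move=> f; apply: psP => m; have hm := ltnSn (mdeg m).
rewrite (ps_mulE _ _ hm).
transitivity ((1 * ps_trunc (mdeg m).+1 f)@_m).
  by apply: eq_mcoeffM => // k hk; rewrite ps_truncE ltnS hk mcoeff1.
by rewrite mul1r ps_truncE hm.
Qed.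

Fact ps_mulD : left_distributive ps_mul ps_add.
Proof.
move=> f g h; apply: psP => m /=; rewrite -big_split /=.
by apply: eq_bigr => k _; rewrite mulrDl.
Qed.

Fact ps_one_neq0 : ps_one != 0.
Proof.
apply/eqP => /(congr1 (fun f => ps_coef f 0%MM)) /= /eqP.
by rewrite eqxx oner_eq0.
Qed.

HB.instance Definition _ := GRing.Zmodule_isComNzRing.Build ps
  ps_mulA ps_mulC ps_mul1 ps_mulD ps_one_neq0.

Definition ps_var (i : 'I_n) : ps := PSeries (fun m => (m == U_(i)%MM)%:R).

End PSeriesRing.
Arguments ps_var {n R} i.

(* From here on, _@_ _ is a coefficient in {malg R[K]}, the free R-module on K. *)
From mathcomp.multinomials Require Import monalg.
Local Notation "x @_ g" := (monalg.mcoeff g x) : ring_scope.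

Section Span.
Variables (R : nzRingType) (V : lmodType R) (S : set V).

Definition span : set V := [set v | exists m (a : 'I_m -> R) (s : 'I_m -> V),
  (forall i, S (s i)) /\ v = \sum_i a i *: s i].

Definition span_pred : {pred V} := fun v => `[< span v >].

Fact span_pred_closed : submod_closed span_pred.
Proof.
split=> [|a u v].
  apply/asboolP; exists 0%N, (fun=> 0), (fun=> 0); split=> [[]//|].
  by rewrite big_ord0.
move=> /asboolP[m1 [a1 [s1 [h1 ->]]]] /asboolP[m2 [a2 [s2 [h2 ->]]]].
apply/asboolP; exists (m1 + m2)%N.
exists (fun i => match split i with inl j => a * a1 j | inr j => a2 j end).
exists (fun i => match split i with inl j => s1 j | inr j => s2 j end).
split=> [i|]; first by case: splitP.
rewrite big_split_ord /= scaler_sumr; congr (_ + _).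
  apply: eq_bigr => i _; case: splitP => j /= E.
    by have /val_inj -> : i = j :> nat by []; rewrite scalerA.
  by have := ltn_ord i; rewrite E ltnNge leq_addr.
apply: eq_bigr => i _; case: splitP => j /= E.
  by have := ltn_ord j; rewrite -E ltnNge leq_addr.
by have /val_inj -> : i = j :> nat by apply/eqP; rewrite -(eqn_add2l m1) E.
Qed.

HB.instance Definition _ := GRing.isSubmodClosed.Build R V span_pred
  span_pred_closed.

Definition quot_mod := Quotient.quot span_pred.

HB.instance Definition _ := GRing.Zmodule.on quot_mod.

Local Open Scope quotient_scope.

Definition quot_scale (a : R) (x : quot_mod) : quot_mod :=
  \pi_(quot_mod) (a *: repr x).

Lemma quot_scale_pi a (v : V) :
  quot_scale a (\pi_(quot_mod) v) = \pi_(quot_mod) (a *: v).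
Proof.
apply/eqP; rewrite /quot_scale -Quotient.idealrBE -scalerBr rpredZ //.
by rewrite Quotient.idealrBE reprK.
Qed.

Lemma quot_piD (u v : V) :
  \pi_(quot_mod) u + \pi_(quot_mod) v = \pi_(quot_mod) (u + v).
Proof. by rewrite piE. Qed.

Fact quot_scaleA a b x : quot_scale a (quot_scale b x) = quot_scale (a * b) x.
Proof.
elim/quotW: x => v; rewrite (quot_scale_pi b) (quot_scale_pi a).
by rewrite (quot_scale_pi (a * b)) scalerA.
Qed.
Fact quot_scale1 : left_id 1 quot_scale.
Proof. by elim/quotW => v; rewrite quot_scale_pi scale1r. Qed.
Fact quot_scaleDr : right_distributive quot_scale +%R.
Proof.
move=> a; elim/quotW=> u; elim/quotW=> v.
by rewrite quot_piD !quot_scale_pi quot_piD scalerDr.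
Qed.
Fact quot_scaleDl x : {morph quot_scale^~ x : a b / a + b}.
Proof.
move=> a b; elim/quotW: x => v.
by rewrite !quot_scale_pi quot_piD scalerDl.
Qed.

HB.instance Definition _ := GRing.Zmodule_isLmodule.Build R quot_mod
  quot_scaleA quot_scale1 quot_scaleDr quot_scaleDl.

End Span.

Section Ideals.
Variable R : comNzRingType.

Definition ideal_gen (S : set R) : set R := @span R R^o S.

Definition ideal_mul (I J : set R) : set R :=
  ideal_gen [set z | exists x y, [/\ I x, J y & z = x * y]].

Definition ideal_exp (I : set R) (d : nat) : set R :=
  iter d (ideal_mul I) setT.

Definition divides (a b : R) : Prop := exists c, b = c * a.

Definition is_gcd (S : set R) (g : R) : Prop :=
  (forall x, S x -> divides g x) /\
  (forall c, (forall x, S x -> divides c x) -> divides c g).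

(* Minors of size r; there are none when r exceeds a dimension of P, and the
   only minor of size 0 is 1. *)
Definition minors (m s : nat) (P : 'M[R]_(m, s)) (r : nat) : set R :=
  [set x | exists (f : 'I_r -> 'I_m) (g : 'I_r -> 'I_s),
     [/\ {homo f : i j / (i < j)%N}, {homo g : i j / (i < j)%N}
       & x = \det (mxsub f g P)]].

(* A is the cokernel of P : R^s -> R^m. *)
Definition presents (A : lmodType R) (m s : nat) (P : 'M[R]_(m, s)) : Prop :=
  exists phi : {linear 'cV[R]_m -> A},
    (forall x, exists v, phi v = x) /\
    (forall v, phi v = 0 <-> exists w, v = P *m w).

(* The ideal generated by the minors of size m - i of a presentation matrix of
   A with m rows; it does not depend on the presentation (Fitting). *)
Definition elementary_ideal (i : nat) (A : lmodType R) : set R :=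
  [set x | exists m s (P : 'M[R]_(m, s)),
     presents A P /\ ideal_gen (minors P (m - i)) x].

End Ideals.

Section GroupRing.
Variables (R : nzRingType) (G : groupType).

Definition grpring := {malg R[G]}.

HB.instance Definition _ := GRing.Lmodule.on grpring.

Implicit Types x y z : grpring.

Definition gr_one : grpring := << 1%g >>.

Definition gr_mul x y : grpring :=
  \sum_(g <- msupp x) \sum_(h <- msupp y) << x@_g * y@_h *g (g * h)%g >>.

Local Open Scope fset_scope.
Local Open Scope ring_scope.

Lemma gr_mulw (d1 d2 : {fset G}) x y : msupp x `<=` d1 -> msupp y `<=` d2 ->
  gr_mul x y = \sum_(g <- d1) \sum_(h <- d2) << x@_g * y@_h *g (g * h)%g >>.
Proof.
move=> le1 le2; rewrite /gr_mul (big_fset_incl _ le1) /=.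
  apply/eq_bigr => g _; apply/big_fset_incl => // h _ /mcoeff_outdom ->.
  by rewrite mulr0 monalgU0.
move=> g _ /mcoeff_outdom g0.
by rewrite big1 // => h _; rewrite g0 mul0r monalgU0.
Qed.

Lemma gr_mulUU a b (g h : G) :
  gr_mul << a *g g >> << b *g h >> = << a * b *g (g * h)%g >>.
Proof. by rewrite (gr_mulw msuppU_le msuppU_le) !big_seq_fset1 !mcoeffUU. Qed.

Fact gr_mulDl : left_distributive gr_mul +%R.
Proof.
move=> x y z.
rewrite [in RHS](gr_mulw (fsubsetUl _ (msupp y)) (fsubset_refl _)).
rewrite [in RHS](gr_mulw (fsubsetUr (msupp x) _) (fsubset_refl _)).
rewrite (gr_mulw (msuppD_le _ _) (fsubset_refl _)).
rewrite -big_split /=; apply/eq_bigr=> g _.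
rewrite -big_split /=; apply/eq_bigr=> h _.
by rewrite mcoeffD mulrDl monalgUD.
Qed.

Fact gr_mulDr : right_distributive gr_mul +%R.
Proof.
move=> x y z.
rewrite [in RHS](gr_mulw (fsubset_refl _) (fsubsetUl _ (msupp z))).
rewrite [in RHS](gr_mulw (fsubset_refl _) (fsubsetUr (msupp y) _)).
rewrite (gr_mulw (fsubset_refl _) (msuppD_le _ _)).
rewrite -big_split /=; apply/eq_bigr=> g _.
rewrite -big_split /=; apply/eq_bigr=> h _.
by rewrite mcoeffD mulrDr monalgUD.
Qed.

Lemma gr_mul0l y : gr_mul 0 y = 0.
Proof. by rewrite /gr_mul msupp0 big_seq_fset0. Qed.
Lemma gr_mul0r x : gr_mul x 0 = 0.
Proof. by rewrite /gr_mul big1 // => g _; rewrite msupp0 big_seq_fset0. Qed.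

Lemma gr_ind (P : grpring -> Prop) :
  P 0 -> (forall x y, P x -> P y -> P (x + y)) ->
  (forall a g, P << a *g g >>) -> forall x, P x.
Proof. by move=> h0 hD hU x; rewrite [x]monalgE; apply: big_ind. Qed.

Fact gr_mulA : associative gr_mul.
Proof.
move=> x y z; elim/gr_ind: x => [|x x' hx hx'|a g].
- by rewrite !gr_mul0l.
- by rewrite !gr_mulDl hx hx'.
elim/gr_ind: y => [|y y' hy hy'|b h].
- by rewrite !(gr_mul0l, gr_mul0r).
- by rewrite !(gr_mulDl, gr_mulDr) hy hy'.
elim/gr_ind: z => [|z z' hz hz'|c l].
- by rewrite !gr_mul0r.
- by rewrite !gr_mulDr hz hz'.
by rewrite !gr_mulUU mulrA mulgA.
Qed.

Fact gr_mul1l : left_id gr_one gr_mul.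
Proof.
move=> x; elim/gr_ind: x => [|x x' hx hx'|a g]; first by rewrite gr_mul0r.
  by rewrite gr_mulDr hx hx'.
by rewrite gr_mulUU mul1r mul1g.
Qed.

Fact gr_mul1r : right_id gr_one gr_mul.
Proof.
move=> x; elim/gr_ind: x => [|x x' hx hx'|a g]; first by rewrite gr_mul0l.
  by rewrite gr_mulDl hx hx'.
by rewrite gr_mulUU mulr1 mulg1.
Qed.

Fact gr_one_neq0 : gr_one != 0.
Proof.
apply/eqP => /malgP /(_ 1%g) /eqP.
by rewrite mcoeffUU mcoeff0 oner_eq0.
Qed.

HB.instance Definition _ := GRing.Zmodule_isNzRing.Build grpring
  gr_mulA gr_mul1l gr_mul1r gr_mulDl gr_mulDr gr_one_neq0.

Definition aug x : R := \sum_(g <- msupp x) x@_g.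

Lemma augw (d : {fset G}) x : msupp x `<=` d -> aug x = \sum_(g <- d) x@_g.
Proof.
by move=> le; apply: big_fset_incl => // g _ /mcoeff_outdom.
Qed.

Lemma augU a g : aug << a *g g >> = a.
Proof. by rewrite (augw msuppU_le) big_seq_fset1 mcoeffUU. Qed.

Fact aug_additive : zmod_morphism aug.
Proof.
move=> x y; rewrite [in RHS](augw (fsubsetUl _ (msupp y))).
rewrite [in RHS](augw (fsubsetUr (msupp x) _)) (augw (msuppB_le _ _)).
by rewrite -sumrB; apply: eq_bigr => g _; rewrite mcoeffB.
Qed.

HB.instance Definition _ := GRing.isZmodMorphism.Build grpring R aug
  aug_additive.

Fact aug_multiplicative : monoid_morphism aug.
Proof.
split=> [|x y]; first exact: augU.
elim/gr_ind: x => [|x x' hx hx'|a g]; first by rewrite mul0r raddf0 mul0r.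
  by rewrite mulrDl !raddfD /= hx hx' mulrDl.
elim/gr_ind: y => [|y y' hy hy'|b h]; first by rewrite mulr0 raddf0 mulr0.
  by rewrite mulrDr !raddfD /= hy hy' mulrDr.
by rewrite [_ * _ in LHS]gr_mulUU !augU.
Qed.

HB.instance Definition _ := GRing.isMonoidMorphism.Build grpring R aug
  aug_multiplicative.

(* The augmentation ideal, as a left module over the group ring. *)
Definition aug_pred : {pred grpring^o} := [pred x | aug x == 0].

Fact aug_pred_closed : submod_closed aug_pred.
Proof.
split=> [|a u v]; rewrite !inE ?raddf0 // => /eqP hu /eqP hv.
have -> : aug (a *: u + v) = aug a * aug u + aug v.
  by rewrite raddfD; congr (_ + _); apply: (rmorphM aug).
by rewrite hu hv mulr0 addr0.
Qed.

HB.instance Definition _ := GRing.isSubmodClosed.Build grpring grpring^o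
  aug_pred aug_pred_closed.

Record aug_mod := AugMod { aug_val : grpring^o; _ : aug_val \in aug_pred }.

HB.instance Definition _ := [isSub for aug_val].
HB.instance Definition _ := [Choice of aug_mod by <:].
HB.instance Definition _ := [SubChoice_isSubLmodule of aug_mod by <:].

End GroupRing.

Arguments aug {R G} x.

Definition gr_map (R S : nzRingType) (G H : groupType)
    (u : R -> S) (f : G -> H) (x : grpring R G) : grpring S H :=
  \sum_(g <- msupp x) << u x@_g *g f g >>.

Section GroupRingMap.
Variables (R S : nzRingType) (G H : groupType).
Variables (u : {rmorphism R -> S}) (f : monoid.UMagmaMorphism.type G H).
Local Open Scope fset_scope.
Local Open Scope ring_scope.

Lemma gr_mapw (d : {fset G}) (x : grpring R G) : msupp x `<=` d ->
  gr_map u f x = \sum_(g <- d) << u x@_g *g f g >>.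
Proof.
move=> le; apply: big_fset_incl => // g _ /mcoeff_outdom ->.
by rewrite rmorph0 monalgU0.
Qed.

Lemma gr_mapU a g : gr_map u f << a *g g >> = << u a *g f g >>.
Proof. by rewrite (gr_mapw msuppU_le) big_seq_fset1 mcoeffUU. Qed.

Fact gr_map_additive : zmod_morphism (gr_map u f).
Proof.
move=> x y; rewrite [in RHS](gr_mapw (fsubsetUl _ (msupp y))).
rewrite [in RHS](gr_mapw (fsubsetUr (msupp x) _)) (gr_mapw (msuppB_le _ _)).
by rewrite -sumrB; apply: eq_bigr => g _; rewrite mcoeffB rmorphB monalgUB.
Qed.

HB.instance Definition _ := GRing.isZmodMorphism.Build
  (grpring R G) (grpring S H) (gr_map u f) gr_map_additive.

Fact gr_map_multiplicative : monoid_morphism (gr_map u f).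
Proof.
split=> [|x y]; first by rewrite gr_mapU rmorph1 gmulf1.
elim/gr_ind: x => [|x x' hx hx'|a g]; first by rewrite mul0r raddf0 mul0r.
  by rewrite mulrDl !raddfD /= hx hx' mulrDl.
elim/gr_ind: y => [|y y' hy hy'|b h]; first by rewrite mulr0 raddf0 mulr0.
  by rewrite mulrDr !raddfD /= hy hy' mulrDr.
rewrite [_ * _ in LHS]gr_mulUU !gr_mapU rmorphM gmulfM.
by rewrite [RHS]gr_mulUU.
Qed.

HB.instance Definition _ := GRing.isMonoidMorphism.Build
  (grpring R G) (grpring S H) (gr_map u f) gr_map_multiplicative.

End GroupRingMap.

(* The B-module B (x)_A N, for B a right A-module through phi, as the free
   B-module on the symbols <<x>> = 1 (x) x modulo the A-balanced biadditive
   relations. *)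
Section BaseChange.
Variables (A B : nzRingType) (phi : {rmorphism A -> B}) (N : lmodType A).

Definition tensor_rel : set {malg B[N]} := [set r |
  (exists x y : N, r = << x + y >> - << x >> - << y >>) \/
  (exists (a : A) (x : N), r = << a *: x >> - << phi a *g x >>)].

Definition base_change : lmodType B := quot_mod tensor_rel.

End BaseChange.

Record nsubgroup (G : groupType) := NSubgroup {
  ns_set :> G -> Prop;
  ns1 : ns_set 1%g;
  nsM : forall x y, ns_set x -> ns_set y -> ns_set (x * y)%g;
  nsV : forall x, ns_set x -> ns_set (x^-1)%g;
  nsJ : forall x y, ns_set x -> ns_set (x ^ y)%g }.

Section QuotientGroup.
Local Open Scope group_scope.
Local Open Scope quotient_scope.
Variables (G : groupType) (N : nsubgroup G).

Definition gequiv (x y : G) : bool := `[< N (x^-1 * y) >].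

Fact gequiv_is_equiv : equiv_class_of gequiv.
Proof.
split=> [x|x y|y x z].
- by apply/asboolP; rewrite mulVg; apply: ns1.
- by apply/asboolP/asboolP => /nsV; rewrite invgM invgK.
move=> /asboolP h1 /asboolP h2; apply/asboolP.
by have := nsM h1 h2; rewrite mulgA mulgK.
Qed.

Canonical gequiv_equiv := EquivRelPack gequiv_is_equiv.
Canonical gequiv_encModRel := defaultEncModRel gequiv.

Definition quotg := {eq_quot gequiv}.

HB.instance Definition _ : EqQuotient G gequiv quotg := EqQuotient.on quotg.
HB.instance Definition _ := Choice.on quotg.

Definition proj (x : G) : quotg := \pi_(quotg) x.

Lemma projP x y : proj x = proj y <-> N (x^-1 * y).
Proof.
split=> [/eqP|h]; first by rewrite /proj piE => /asboolP.
by apply/eqP; rewrite /proj piE; apply/asboolP.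
Qed.

Definition quotg_one : quotg := proj 1.
Definition quotg_mul (x y : quotg) : quotg := proj (repr x * repr y).
Definition quotg_inv (x : quotg) : quotg := proj (repr x)^-1.

Lemma repr_proj x : N (x^-1 * repr (proj x)).
Proof. by apply/projP; rewrite {2}/proj [RHS]reprK. Qed.

Lemma quotg_mulE x y : quotg_mul (proj x) (proj y) = proj (x * y).
Proof.
apply/esym/projP; rewrite invgM.
have hx := nsJ y (repr_proj x); have hy := repr_proj y.
by have := nsM hx hy; rewrite conjgE !mulgA mulgK.
Qed.

Lemma quotg_invE x : quotg_inv (proj x) = proj x^-1.
Proof.
apply/projP; rewrite invgK.
have := nsJ (x^-1) (repr_proj x).
by rewrite conjgE invgK !mulgA mulgV mul1g.
Qed.

Lemma projE (X : quotg) : X = proj (repr X).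
Proof. by rewrite /proj reprK. Qed.

Fact quotg_mulA : associative quotg_mul.
Proof.
move=> x y z; rewrite (projE x) (projE y) (projE z).
by rewrite !quotg_mulE mulgA.
Qed.
Fact quotg_mul1l : left_id quotg_one quotg_mul.
Proof. by move=> x; rewrite (projE x) quotg_mulE mul1g. Qed.
Fact quotg_mul1r : right_id quotg_one quotg_mul.
Proof. by move=> x; rewrite (projE x) quotg_mulE mulg1. Qed.
Fact quotg_mulV : left_inverse quotg_one quotg_inv quotg_mul.
Proof. by move=> x; rewrite (projE x) quotg_invE quotg_mulE mulVg. Qed.
Fact quotg_mulrV : right_inverse quotg_one quotg_inv quotg_mul.
Proof. by move=> x; rewrite (projE x) quotg_invE quotg_mulE mulgV. Qed.

HB.instance Definition _ := isGroup.Build quotg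
  quotg_mulA quotg_mul1l quotg_mul1r quotg_mulV quotg_mulrV.

Fact proj_multiplicative : {morph proj : x y / x * y}.
Proof. by move=> x y; rewrite -quotg_mulE. Qed.
Fact proj_one : proj 1 = 1.
Proof. by []. Qed.

HB.instance Definition _ := monoid.isMultiplicative.Build G quotg proj
  proj_multiplicative.
HB.instance Definition _ := monoid.Multiplicative_isUMagmaMorphism.Build G quotg proj
  proj_one.

End QuotientGroup.

Section Abelianization.
Local Open Scope group_scope.
Variable G : groupType.

(* The inverse of a commutator is a commutator, so products suffice. *)
Definition derived_set : set G := [set x | exists s : seq (G * G),
  x = \prod_(c <- s) [~ c.1, c.2]].

Fact derived1 : derived_set 1.
Proof. by exists [::]; rewrite big_nil. Qed.
Fact derivedM x y : derived_set x -> derived_set y -> derived_set (x * y).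
Proof. by move=> [s ->] [s' ->]; exists (s ++ s'); rewrite big_cat. Qed.
Lemma derivedR (x y : G) : derived_set [~ x, y].
Proof. by exists [:: (x, y)]; rewrite big_seq1. Qed.
Fact derivedV x : derived_set x -> derived_set x^-1.
Proof.
move=> [s ->]; elim: s => [|[a b] s IH]; first by rewrite big_nil invg1; apply: derived1.
by rewrite big_cons invgM; apply: derivedM => //=; rewrite invgR; apply: derivedR.
Qed.
Fact derivedJ x y : derived_set x -> derived_set (x ^ y).
Proof.
move=> hx; rewrite -[x ^ y](mulVKg x) -commgEl.
by apply: derivedM => //; apply: derivedR.
Qed.

Definition derived : nsubgroup G :=
  NSubgroup derived1 derivedM derivedV derivedJ.

Definition Gab := quotg derived.

HB.instance Definition _ := Group.on Gab.

Fact Gab_mulC (x y : Gab) : x * y = y * x.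
Proof.
rewrite (projE x) (projE y) -[LHS]gmulfM -[RHS]gmulfM; apply/projP.
by have := derivedR (repr y) (repr x); rewrite commgEl conjgE invgM !mulgA.
Qed.

Definition torsion_set : set Gab := [set x | exists2 k, (0 < k)%N & x ^+ k = 1].

Fact torsion1 : torsion_set 1.
Proof. by exists 1%N. Qed.
Fact torsionM x y : torsion_set x -> torsion_set y -> torsion_set (x * y).
Proof.
move=> [k k0 hk] [l l0 hl]; exists (k * l)%N; first by rewrite muln_gt0 k0.
rewrite expgMn; last exact: Gab_mulC.
by rewrite expgnA hk expg1n mul1g mulnC expgnA hl expg1n.
Qed.
Fact torsionV x : torsion_set x -> torsion_set x^-1.
Proof. by move=> [k k0 hk]; exists k => //; rewrite expVgn hk invg1. Qed.
Fact torsionJ x y : torsion_set x -> torsion_set (x ^ y).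
Proof. by rewrite conjgE Gab_mulC mulgK. Qed.

Definition torsion : nsubgroup Gab :=
  NSubgroup torsion1 torsionM torsionV torsionJ.

Definition Gabf := quotg torsion.

HB.instance Definition _ := Group.on Gabf.

Fact Gabf_mulC (x y : Gabf) : x * y = y * x.
Proof.
by rewrite (projE x) (projE y) -[LHS]gmulfM -[RHS]gmulfM Gab_mulC.
Qed.

Definition abf : G -> Gabf := proj torsion \o proj derived.

HB.instance Definition _ := monoid.UMagmaMorphism.on abf.

End Abelianization.

Section LaurentRing.
Variables (R : comNzRingType) (G : groupType).

Fact gr_Gabf_mulC : commutative (@gr_mul R (Gabf G)).
Proof.
move=> x y; rewrite /gr_mul exchange_big /=.
apply: eq_bigr => g _; apply: eq_bigr => h _.
by rewrite mulrC Gabf_mulC.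
Qed.

HB.instance Definition _ := GRing.PzRing_hasCommutativeMul.Build
  (grpring R (Gabf G)) gr_Gabf_mulC.

End LaurentRing.

Definition expgz (G : groupType) (g : G) (z : int) : G :=
  match z with Posz k => (g ^+ k)%g | Negz k => (g ^- k.+1)%g end.

Definition is_Zbasis (H : groupType) (n : nat) (t : 'I_n -> H) : Prop :=
  forall g : H, exists! a : {ffun 'I_n -> int},
    g = (\prod_(i < n) expgz (t i) (a i))%g.

(* (i, true) and (i, false) stand for the i-th generator and its inverse. *)
Definition word (m : nat) := seq ('I_m * bool).

(* Equality in the group with m generators and relators in rels. *)
Inductive pres_eq (m : nat) (rels : seq (word m)) : word m -> word m -> Prop :=
| PresRefl w : pres_eq rels w w
| PresSym v w : pres_eq rels v w -> pres_eq rels w v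
| PresTrans u v w : pres_eq rels u v -> pres_eq rels v w -> pres_eq rels u w
| PresCat u u' v v' : pres_eq rels u u' -> pres_eq rels v v' ->
    pres_eq rels (u ++ v) (u' ++ v')
| PresCancel i b : pres_eq rels [:: (i, b); (i, ~~ b)] [::]
| PresRel r : r \in rels -> pres_eq rels r [::].

Definition word_eval (G : groupType) (m : nat) (g : 'I_m -> G) (w : word m) : G :=
  (\prod_(l <- w) if l.2 then g l.1 else (g l.1)^-1)%g.

Definition finitely_presented (G : groupType) : Prop :=
  exists m (rels : seq (word m)) (g : 'I_m -> G),
    (forall x, exists w, word_eval g w = x) /\
    (forall v w, word_eval g v = word_eval g w <-> pres_eq rels v w).

(* In the (inhomogeneous) bar complex with trivial coefficients K, C_1 = K[G],
   the boundary C_1 -> C_0 is zero, and [g|h] has boundary [h] - [gh] + [g]. *)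
Definition bar_boundaries (G : groupType) (K : fieldType) : set {malg K[G]} :=
  [set r | exists g h : G, r = << h >> - << (g * h)%g >> + << g >>].

Definition H1 (G : groupType) (K : fieldType) : lmodType K :=
  quot_mod (@bar_boundaries G K).

Definition has_dim (K : fieldType) (V : lmodType K) (n : nat) : Prop :=
  exists b : 'I_n -> V, forall v, exists! c : 'rV[K]_n,
    v = \sum_i c 0 i *: b i.

Definition is_b1 (G : groupType) (K : fieldType) (n : nat) : Prop :=
  has_dim (H1 G K) n.

Section Alexander.
Variable G : groupType.

(* Z[G_abf]; a basis t of G_abf identifies it with Z[t_1^+-1, ..., t_n^+-1]. *)
Definition Lambda : comNzRingType := grpring int (Gabf G).

(* Lambda (x)_{Z[G]} I_G *)
Definition alexander_module : lmodType Lambda :=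
  @base_change (grpring int G) (grpring int (Gabf G))
    (gr_map (@idfun int) (@abf G)) (aug_mod int G).

Definition alexander_ideal : set Lambda :=
  elementary_ideal 1 alexander_module.

Definition is_alexander_poly (Delta : Lambda) : Prop :=
  is_gcd alexander_ideal Delta.

Variable K : fieldType.

Definition LambdaK : comNzRingType := grpring K (Gabf G).

Definition to_LambdaK (x : Lambda) : LambdaK :=
  gr_map (fun a : int => a%:~R) idfun x.

Definition almost_principal (d : nat) (Delta : Lambda) : Prop :=
  ideal_mul (ideal_exp [set x : LambdaK | aug x = 0] d)
            (ideal_gen [set to_LambdaK Delta])
  `<=` ideal_gen (to_LambdaK @` alexander_ideal).

End Alexander.

(* The Magnus expansion: there is exactly one such ring morphism. *)
Definition is_magnus (G : groupType) (K : fieldType) (n : nat)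
    (t : 'I_n -> Gabf G) (e : {rmorphism Lambda G -> pseries n K}) : Prop :=
  forall i, e << t i >> = 1 + ps_var i.

Definition ps_max (n : nat) (K : fieldType) : set (pseries n K) :=
  ideal_gen (range (@ps_var n K)).
Arguments ps_max : clear implicits.

Definition has_char (K : fieldType) (p : nat) : Prop :=
  forall m : nat, ((m%:R : K) == 0) = (p %| m)%N.

(* Main.v *)
Require Import Defs.
From HB Require Import structures.
From mathcomp Require Import all_boot all_algebra generic_quotient ring_quotient.
From mathcomp Require Import zify.
From mathcomp.classical Require Import boolp classical_sets.
From mathcomp.finmap Require Import finmap.
From mathcomp.multinomials Require Import monalg.
From mathcomp.multinomials Require Import mpoly.

(** The rule [b (x) x |-> b(1) [x]] defines a map from the Alexander module onto
    [H_1(G, K)], semilinear along the augmentation.  Hence, if [A_G] is presented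
    by [P] with [m] rows, the value of [P] at [1] in [K] has rank at most
    [m - n_p].  A determinant of size [k] over [K[[x]]] whose constant part has
    rank at most [r] has order at least [k - r], so the elements of [E_1(A_G)]
    have order at least [n_p - 1].  Since [(t_1 - 1)^d] maps to [x_1^d], the almost
    principal condition loses at most [d] of this order. *)

Set Implicit Arguments.
Unset Strict Implicit.
Unset Printing Implicit Defensive.

Import GRing.Theory.

Local Open Scope ring_scope.

(** * Power series over a field: constants, order, determinants, powers of the maximal ideal *)

Section PowerSeries.
Variables (n : nat) (K : fieldType).
Local Notation ps := (pseries n K).
Implicit Types f g : ps.

Lemma ps_coefM f g m : ps_coef (f * g) m =
  \sum_(k : 'X_{1.. n < (mdeg m).+1, (mdeg m).+1} | m == (k.1 + k.2)%MM)
    ps_coef f k.1 * ps_coef g k.2.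
Proof. by []. Qed.

Lemma ps_coef_sum (I : Type) (r : seq I) (P : pred I) (F : I -> ps) m :
  ps_coef (\sum_(i <- r | P i) F i) m = \sum_(i <- r | P i) ps_coef (F i) m.
Proof. exact: (big_morph (fun f : ps => ps_coef f m)). Qed.

(** All pairs of the Cauchy product with first exponent other than [u] contribute zero, and
    cancelling [u] in the sum of exponents forces the second one to be [v]. Applied below with [f] a
    constant or a variable. *)
Lemma ps_coefM_unit f g (u v : 'X_{1.. n}) :
  (forall w, w != u -> ps_coef f w = 0) ->
  ps_coef (f * g) (u + v)%MM = ps_coef f u * ps_coef g v.
Proof.
move=> f0; rewrite ps_coefM; set b := (mdeg _).+1.
have hu : (mdeg u < b)%N by rewrite ltnS mdegD leq_addr.
have hv : (mdeg v < b)%N by rewrite ltnS mdegD leq_addl.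
rewrite (bigD1 (BMultinom hu, BMultinom hv)) //= big1 ?addr0 //.
move=> -[k1 k2] /andP[/eqP /= E ne].
have [E1|/f0->] := eqVneq (val k1) u; last by rewrite mul0r.
case/negP: ne; rewrite E1 in E; have/eqP E2 := E.
rewrite eqm_add2l in E2; apply/eqP; congr pair; apply: val_inj => //=.
exact/esym/eqP.
Qed.

Definition ps_const (c : K) : ps := PSeries (fun m => c *+ (m == 0%MM)).

Lemma ps_coef_constM c f m : ps_coef (ps_const c * f) m = c * ps_coef f m.
Proof.
rewrite -[m in LHS]add0m ps_coefM_unit /= ?eqxx // => w /negbTE w0.
by rewrite /= w0.
Qed.

Fact ps_const_is_zmod_morphism : zmod_morphism ps_const.
Proof. by move=> a b; apply: psP => m; rewrite /= mulrnBl. Qed.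

HB.instance Definition _ :=
  GRing.isZmodMorphism.Build K ps ps_const ps_const_is_zmod_morphism.

Fact ps_const_is_monoid_morphism : monoid_morphism ps_const.
Proof.
split=> [|a b]; first by apply: psP.
by apply: psP => m; rewrite ps_coef_constM /= mulrnAr.
Qed.

HB.instance Definition _ :=
  GRing.isMonoidMorphism.Build K ps ps_const ps_const_is_monoid_morphism.

Definition const_coef f : K := ps_coef f 0%MM.

Fact const_coef_is_zmod_morphism : zmod_morphism const_coef.
Proof. by []. Qed.

HB.instance Definition _ :=
  GRing.isZmodMorphism.Build ps K const_coef const_coef_is_zmod_morphism.

Fact const_coef_is_monoid_morphism : monoid_morphism const_coef.
Proof.
split=> [|f g]; first by rewrite /const_coef /= eqxx.
rewrite /const_coef ps_coefM.
have h0 : (mdeg (0%MM : 'X_{1.. n}) < (mdeg (0%MM : 'X_{1.. n})).+1)%N by [].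
rewrite (bigD1 (BMultinom h0, BMultinom h0)) /= ?addm0 // big1 ?addr0 //.
move=> -[k1 k2] /andP[/eqP /= E /negP []].
have /eqP : (0 = mdeg k1 + mdeg k2)%N by rewrite -mdegD -E mdeg0.
rewrite eq_sym addn_eq0 !mdeg_eq0 => /andP[/eqP k10 /eqP k20].
by apply/eqP; congr pair; apply: val_inj.
Qed.

HB.instance Definition _ :=
  GRing.isMonoidMorphism.Build ps K const_coef const_coef_is_monoid_morphism.

Lemma const_coefD f g : const_coef (f + g) = const_coef f + const_coef g.
Proof. by []. Qed.

Lemma const_coefM f g : const_coef (f * g) = const_coef f * const_coef g.
Proof. exact: rmorphM. Qed.

Lemma const_coef1 : const_coef 1 = 1.
Proof. exact: rmorph1. Qed.

Lemma const_coefK c : const_coef (ps_const c) = c.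
Proof. by rewrite /const_coef /= eqxx mulr1n. Qed.

(** Membership in the [k]-th power of the maximal ideal, in a coefficientwise form that is easy to
    propagate through sums and products; [ord_ge_ideal_exp] returns to the ideal. *)
Definition ord_ge (k : nat) f : Prop :=
  forall m, (mdeg m < k)%N -> ps_coef f m = 0.

Lemma ord_ge1 f : const_coef f = 0 -> ord_ge 1 f.
Proof. by move=> f0 m; rewrite ltnS leqn0 mdeg_eq0 => /eqP ->. Qed.

Lemma ord_geW k l f : (l <= k)%N -> ord_ge k f -> ord_ge l f.
Proof. by move=> lk hf m hm; apply: hf; apply: leq_trans hm lk. Qed.

Lemma ord_ge_sum k (I : Type) (r : seq I) (P : pred I) (F : I -> ps) :
  (forall i, P i -> ord_ge k (F i)) -> ord_ge k (\sum_(i <- r | P i) F i).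
Proof. by move=> hF m hm; rewrite ps_coef_sum big1 // => i /hF ->. Qed.

Lemma ord_geM k l f g : ord_ge k f -> ord_ge l g -> ord_ge (k + l) (f * g).
Proof.
move=> hf hg m hm; rewrite ps_coefM big1 // => -[k1 k2] /eqP /= mE.
have [/hf->|k_le] := ltnP (mdeg k1) k; first by rewrite mul0r.
rewrite hg ?mulr0 // -(ltn_add2l k); apply: leq_ltn_trans hm.
have dE : mdeg m = (mdeg k1 + mdeg k2)%N by rewrite -mdegD -mE.
by rewrite [X in (_ <= X)%N]dE leq_add2r.
Qed.

Lemma ord_geMl k f g : ord_ge k g -> ord_ge k (f * g).
Proof. exact: (@ord_geM 0). Qed.

Lemma ord_ge_prod (I : finType) (a : I -> nat) (F : I -> ps) :
  (forall i, ord_ge (a i) (F i)) -> ord_ge (\sum_i a i) (\prod_i F i).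
Proof.
by move=> hF; apply: (big_ind2 ord_ge) => // *; apply: ord_geM.
Qed.

(** Counts the rows of index at least [r] among [k]: each of them will contribute one to the order
    of a product over all rows. *)
Lemma sum_leq_ord k r : (k - r <= \sum_(i < k) (r <= i))%N.
Proof.
elim: k => [|k IH]; first by rewrite sub0n.
rewrite big_ord_recr /=; case: (leqP r k) => h; last first.
  by rewrite (_ : (k.+1 - r = 0)%N) //; apply/eqP; rewrite subn_eq0.
by rewrite subSn // addn1 ltnS.
Qed.

(* Constant row operations make all but [\rank M0] rows of the constant part
   [M0] vanish; every term of the Leibniz formula then has a factor of positive
   order in each of the other rows. *)
Lemma ord_ge_det k (M : 'M[ps]_k) :
  ord_ge (k - \rank (map_mx const_coef M)) (\det M).
Proof.
set M0 := map_mx _ M; set r := \rank M0; pose L := col_ebase M0.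
have Lu : L \in unitmx := col_ebase_unit M0.
pose N := map_mx ps_const (invmx L) *m M.
have rowN (i j : 'I_k) : (r <= i)%N -> const_coef (N i j) = 0.
  move=> ri; have -> : const_coef (N i j) = (invmx L *m M0) i j.
    rewrite !mxE rmorph_sum; apply: eq_bigr => l _.
    by rewrite rmorphM !mxE; congr (_ * _); apply: const_coefK.
  (* [M0] factors as [L] times [pid_mx r] times an invertible matrix; removing [L] leaves a matrix
     whose rows from [r] on vanish. *)
  rewrite -(mulmx_ebase M0) -mulmxA mulKmx // mxE big1 // => l _.
  by rewrite mxE ltnNge ri andbF mul0r.
have -> : \det M = ps_const (\det L) * \det N.
  rewrite det_mulmx mulrA det_map_mx -rmorphM -det_mulmx mulmxV //.
  by rewrite det1 rmorph1 mul1r.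
apply/ord_geMl/ord_ge_sum => s _; apply: ord_geMl.
apply: ord_geW (sum_leq_ord k r) _; apply: ord_ge_prod => i.
by case: (leqP r i) => // ri; apply/ord_ge1/rowN.
Qed.

Lemma ps_coef_varM i f (m : 'X_{1.. n}) :
  ps_coef (ps_var i * f) (U_(i) + m)%MM = ps_coef f m.
Proof.
by rewrite ps_coefM_unit /= ?eqxx ?mul1r // => w /negbTE /= ->.
Qed.

Lemma ps_coef_varM0 i f (m : 'X_{1.. n}) :
  m i = 0%N -> ps_coef (ps_var i * f) m = 0.
Proof.
move=> mi; rewrite ps_coefM big1 // => -[k1 k2] /= /eqP mE.
case: eqP => [E|_]; last by rewrite mul0r.
have : m i = (k1 i + k2 i)%N by rewrite -mnmDE -mE.
by rewrite mi E mnm1E eqxx.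
Qed.

Lemma ps_coef_varM_gt0 i f (m : 'X_{1.. n}) : (0 < m i)%N ->
  ps_coef (ps_var i * f) m = ps_coef f (m - U_(i))%MM.
Proof.
by move=> mi; rewrite -{1}(submK (_ : U_(i) <= m)%MM) ?lep1mP -?lt0n // addmC
  ps_coef_varM.
Qed.

(** Multiplication by a variable only shifts exponents by [U_(i)], so every coefficient of [f]
    reappears exactly one degree higher; the induction removes one factor at a time. *)
Lemma ord_ge_varX k d i f : ord_ge k (ps_var i ^+ d * f) -> ord_ge (k - d) f.
Proof.
elim: d k f => [|d IH] k f; first by rewrite mul1r subn0.
rewrite exprSr -mulrA => /IH hf m hm; rewrite -(ps_coef_varM i); apply: hf.
by rewrite mdegD mdeg1 ltn_subRL addnA addn1 -ltn_subRL.
Qed.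

(** By induction on [k]: dividing each monomial by one of its variables writes [f] as a finite sum
    of variables times series of order one less. *)
Lemma ord_ge_ideal_exp k f : ord_ge k f -> ideal_exp (ps_max n K) k f.
Proof.
elim: k f => [//|k IH] f hf.
(* [m] is charged to the first variable that divides it. *)
pose part i : ps :=
  PSeries (fun m => ps_coef f (U_(i) + m)%MM *+
    [forall j : 'I_n, (j < i)%N ==> (m j == 0%N)]).
have partP i : ord_ge k (part i).
  by move=> m hm; rewrite /= hf ?mul0rn // mdegD mdeg1.
exists n, (fun=> 1), (fun i => ps_var i * part i); split=> [i|].
  exists (ps_var i), (part i); split=> //; last exact: IH.
  exists 1%N, (fun=> 1), (fun=> ps_var i); split; first by exists i.
  by rewrite big_ord1 scale1r.
apply: psP => m; rewrite ps_coef_sum.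
under eq_bigr do rewrite scale1r.
have [m0|[i1 i1P]] : m = 0%MM \/ exists i, (0 < m i)%N.
  have [m0|/forallPn[i]] := boolP [forall i, m i == 0%N]; last first.
    by rewrite -lt0n; right; exists i.
  by left; apply/mnmP => i; rewrite mnm0E; apply/eqP/(forallP m0).
- rewrite m0 hf ?mdeg0 // big1 // => i _.
  by rewrite ps_coef_varM0 // mnm0E.
(* With [i0] the first variable dividing [m], the summand of index [i0] alone carries the
   coefficient of [f] at [m]. *)
case: (@arg_minnP _ i1 (fun i => 0 < m i)%N (@nat_of_ord n) i1P) => i0 i0P i0min.
have mE i : (0 < m i)%N -> m = (U_(i) + (m - U_(i)))%MM.
  by move=> mi; rewrite addmC submK // lep1mP -lt0n.
rewrite (bigD1 i0) // ps_coef_varM_gt0 // {1}/part [X in _ = X + _]/= -(mE _ i0P).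
rewrite (_ : [forall _, _]) ?mulr1n; last first.
  apply/forallP => j; apply/implyP => ji; rewrite mnmBE.
  have -> // : m j = 0%N.
  by apply/eqP; rewrite -leqn0 leqNgt; apply/negP => /i0min; rewrite leqNgt ji.
rewrite big1 ?addr0 // => i ne.
have [mi|mi] := posnP (m i); first exact: ps_coef_varM0.
(* Another variable [i] dividing [m] comes after [i0], which still divides [m - U_(i)]; hence the
   test in [part i] fails. *)
rewrite ps_coef_varM_gt0 //=.
case: forallP => // /(_ i0); rewrite ltn_neqAle i0min // andbT.
rewrite mnmBE mnm1E (negbTE ne) subn0 eqn0Ngt i0P.
by rewrite -[(_ == _ :> nat)]/(i0 == i) eq_sym (negbTE ne).
Qed.

End PowerSeries.

Local Notation "x @_ g" := (monalg.mcoeff g x) : ring_scope.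

(** * Semilinear maps out of free modules, quotients and base changes *)

Section Lift.
Variables (T : choiceType) (R K : nzRingType) (V : lmodType K).
Variables (u : {rmorphism R -> K}) (f : T -> V).
Local Open Scope fset_scope.
Local Open Scope ring_scope.

Definition malg_lift (r : {malg R[T]}) : V :=
  \sum_(k <- monalg.msupp r) u r@_k *: f k.

Lemma malg_liftw (D : {fset T}) r : monalg.msupp r `<=` D ->
  malg_lift r = \sum_(k <- D) u r@_k *: f k.
Proof.
move=> le; apply: big_fset_incl => // k _ /monalg.mcoeff_outdom ->.
by rewrite rmorph0 scale0r.
Qed.

Lemma malg_liftU a k : malg_lift << a *g k >> = u a *: f k.
Proof. by rewrite (malg_liftw monalg.msuppU_le) big_seq_fset1 monalg.mcoeffUU. Qed.

Fact malg_lift_is_zmod_morphism : zmod_morphism malg_lift.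
Proof.
move=> x y; rewrite [in RHS](malg_liftw (fsubsetUl _ (monalg.msupp y))).
rewrite [in RHS](malg_liftw (fsubsetUr (monalg.msupp x) _)).
rewrite (malg_liftw (monalg.msuppB_le _ _)) -sumrB; apply: eq_bigr => k _.
by rewrite monalg.mcoeffB rmorphB scalerBl.
Qed.

HB.instance Definition _ := GRing.isZmodMorphism.Build {malg R[T]} V malg_lift
  malg_lift_is_zmod_morphism.

Lemma malg_liftZ c r : malg_lift (c *: r) = u c *: malg_lift r.
Proof.
rewrite (malg_liftw (monalg.msuppZ_le c r)) scaler_sumr; apply: eq_bigr => k _.
by rewrite monalg.mcoeffZ rmorphM scalerA.
Qed.

End Lift.

Section Quotient.
Variables (R : nzRingType) (V : lmodType R) (S : set V).
Local Open Scope quotient_scope.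

Definition quot_pi (v : V) : quot_mod S := \pi_(quot_mod S) v.

Fact quot_pi_is_linear : linear quot_pi.
Proof. by move=> a v w; rewrite /quot_pi -quot_piD -quot_scale_pi. Qed.

HB.instance Definition _ :=
  GRing.isLinear.Build R V (quot_mod S) _ quot_pi quot_pi_is_linear.

Lemma quot_pi_surj x : exists v, x = quot_pi v.
Proof. by exists (repr x); rewrite /quot_pi reprK. Qed.

Lemma quot_pi_eq0 (v : V) : S v -> quot_pi v = 0.
Proof.
move=> Sv; rewrite -(raddf0 quot_pi).
apply/eqP; rewrite -Quotient.idealrBE subr0; apply/asboolP.
by exists 1%N, (fun=> 1), (fun=> v); rewrite big_ord1 scale1r.
Qed.

(** The representative chosen by [repr] differs from [v] by a combination of elements of [S], which
    a semilinear map vanishing on [S] kills. So [f \o repr] is the induced map on the quotient. *)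
Lemma quot_pi_lift (K : nzRingType) (W : lmodType K) (u : {rmorphism R -> K})
    (f : {additive V -> W}) (v : V) :
  (forall c x, f (c *: x) = u c *: f x) -> (forall x, S x -> f x = 0) ->
  f (repr (quot_pi v)) = f v.
Proof.
move=> fZ f0; apply/eqP; rewrite -subr_eq0 -raddfB.
have : repr (quot_pi v) - v \in span_pred S.
  by rewrite Quotient.idealrBE reprK.
move=> /asboolP[m [a [s [hs ->]]]]; rewrite raddf_sum big1 // => i _.
by rewrite fZ f0 // scaler0.
Qed.

End Quotient.

Section BaseChangeLift.
Variables (A B K : nzRingType) (phi : {rmorphism A -> B}) (N : lmodType A).
Variables (W : lmodType K) (u : {rmorphism B -> K}) (h : {additive N -> W}).
Hypothesis hZ : forall a x, h (a *: x) = u (phi a) *: h x.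

Definition base_change_lift (z : base_change phi N) : W :=
  malg_lift u h (repr z).

(** Independence of the representative: the additive tensor relations die because [h] is additive,
    the balancing ones by [hZ]. *)
Lemma base_change_lift_pi r :
  base_change_lift (quot_pi _ r) = malg_lift u h r.
Proof.
apply: (quot_pi_lift (u := u)); first exact: malg_liftZ.
move=> _ [[x [y ->]]|[a [x ->]]].
  rewrite !raddfB /= !malg_liftU rmorph1 !scale1r raddfD.
  by rewrite [X in X - _]addrAC subrr add0r subrr.
by rewrite raddfB /= !malg_liftU rmorph1 scale1r hZ subrr.
Qed.

Fact base_change_lift_is_zmod_morphism : zmod_morphism base_change_lift.
Proof.
move=> x y; have [[v ->] [w ->]] := (quot_pi_surj x, quot_pi_surj y).
by rewrite -raddfB !base_change_lift_pi raddfB.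
Qed.

Lemma base_change_liftZ (b : B) z :
  base_change_lift (b *: z) = u b *: base_change_lift z.
Proof.
have [v ->] := quot_pi_surj z.
by rewrite -linearZ !base_change_lift_pi malg_liftZ.
Qed.

Lemma base_change_liftU x :
  base_change_lift (quot_pi _ << x >>) = h x.
Proof. by rewrite base_change_lift_pi malg_liftU rmorph1 scale1r. Qed.

End BaseChangeLift.

(** * The augmentation with values in [K], and first homology classes of group ring elements *)

Section AugmentationK.
Variables (G : groupType) (K : fieldType).

Definition augK (x : grpring int G) : K := (aug x)%:~R.

Fact augK_is_zmod_morphism : zmod_morphism augK.
Proof. by move=> x y; rewrite /augK raddfB intrB. Qed.

HB.instance Definition _ := GRing.isZmodMorphism.Build (grpring int G) K augK
  augK_is_zmod_morphism.

Fact augK_is_monoid_morphism : monoid_morphism augK.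
Proof.
by split=> [|x y]; rewrite /augK ?rmorph1 // (rmorphM aug) intrM.
Qed.

HB.instance Definition _ := GRing.isMonoidMorphism.Build (grpring int G) K augK
  augK_is_monoid_morphism.

Lemma augKU a g : augK << a *g g >> = a%:~R.
Proof. by rewrite /augK augU. Qed.

End AugmentationK.

Section Abelian.
Variables (G : groupType) (K : fieldType).
Local Notation augK := (@augK G K).
Local Open Scope quotient_scope.

Definition bar_class (g : G) : H1 G K := quot_pi (@bar_boundaries G K) << g >>.

(** This is the boundary of the 2-chain [[g|h]] read in homology. *)
Lemma bar_classM g h : bar_class (g * h)%g = bar_class g + bar_class h.
Proof.
have /quot_pi_eq0 : bar_boundaries (<< h >> - << (g * h)%g >> + << g >> : {malg K[G]}).
  by exists g, h.
rewrite raddfD raddfB /= => /eqP; rewrite addrAC subr_eq0 addrC => /eqP E.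
exact/esym.
Qed.

Lemma bar_class1 : bar_class 1%g = 0.
Proof.
by apply/(addrI (bar_class 1%g)); rewrite -bar_classM mulg1 addr0.
Qed.

Definition gr_class : grpring int G -> H1 G K := malg_lift intr bar_class.

Fact gr_class_is_zmod_morphism : zmod_morphism gr_class.
Proof. exact: raddfB. Qed.

HB.instance Definition _ := GRing.isZmodMorphism.Build (grpring int G) (H1 G K)
  gr_class gr_class_is_zmod_morphism.

Lemma gr_classU a g : gr_class << a *g g >> = a%:~R *: bar_class g.
Proof. exact: malg_liftU. Qed.

(** A Leibniz rule along the augmentation: on group elements it is [bar_classM], and both sides are
    biadditive. *)
Lemma gr_classM (x y : grpring int G) :
  gr_class (x * y) = augK x *: gr_class y + augK y *: gr_class x.
Proof.
elim/gr_ind: x => [|x x' hx hx'|a g].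
- by rewrite mul0r !raddf0 scale0r addr0.
- rewrite mulrDl [LHS]raddfD [augK (_ + _)]raddfD [gr_class (_ + _)]raddfD /=.
  by rewrite hx hx' scalerDl scalerDr; apply: addrACA.
elim/gr_ind: y => [|y y' hy hy'|b h].
- by rewrite mulr0 !raddf0 scale0r addr0.
- rewrite mulrDr [LHS]raddfD [augK (_ + _)]raddfD [gr_class (_ + _)]raddfD /=.
  by rewrite hy hy' scalerDl scalerDr; apply: addrACA.
rewrite [_ * _ in LHS]gr_mulUU !gr_classU !augKU bar_classM.
by rewrite intrM scalerDr !scalerA addrC [b%:~R * _]mulrC.
Qed.

End Abelian.

(** * From the Alexander module onto first homology *)

Section AlexanderHomology.
Variables (G : groupType) (K : fieldType).
Local Notation N := (aug_mod int G).
Local Notation abf_map := (gr_map (@idfun int) (@abf G)).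

Lemma augK_abf (x : grpring int G) : augK K (abf_map x) = augK K x.
Proof.
elim/gr_ind: x => [|x x' hx hx'|a g].
- by rewrite (raddf0 abf_map) !(raddf0 (augK K)).
- by rewrite (raddfD abf_map) [LHS]raddfD [RHS]raddfD; congr (_ + _).
- by rewrite gr_mapU !augKU.
Qed.

Definition aug_class (x : N) : H1 G K := gr_class K (aug_val x).

Fact aug_class_is_zmod_morphism : zmod_morphism aug_class.
Proof. by move=> x y; apply: raddfB. Qed.

HB.instance Definition _ := GRing.isZmodMorphism.Build N (H1 G K) aug_class
  aug_class_is_zmod_morphism.

Lemma augK_aug_val (x : N) : augK K (aug_val x) = 0.
Proof. by case: x => x /= /eqP hx; rewrite /augK hx. Qed.

(** On the augmentation ideal the second term of the Leibniz rule vanishes, so the class map is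
    semilinear; as the augmentation factors through [abf], it extends to the base change. *)
Lemma aug_classZ a (x : N) :
  aug_class (a *: x) = augK K (abf_map a) *: aug_class x.
Proof.
rewrite augK_abf /aug_class; have -> : aug_val (a *: x) = a * aug_val x by [].
by rewrite gr_classM augK_aug_val scale0r addr0.
Qed.

(* [b (x) x |-> b(1) [x]] *)
Definition alexander_to_H1 : alexander_module G -> H1 G K :=
  base_change_lift (@augK (Gabf G) K) aug_class.

Fact alexander_to_H1_is_zmod_morphism : zmod_morphism alexander_to_H1.
Proof. exact: (base_change_lift_is_zmod_morphism aug_classZ). Qed.

HB.instance Definition _ := GRing.isZmodMorphism.Build (alexander_module G)
  (H1 G K) alexander_to_H1 alexander_to_H1_is_zmod_morphism.

Lemma alexander_to_H1Z (a : Lambda G) (x : alexander_module G) :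
  alexander_to_H1 (a *: x) = augK K a *: alexander_to_H1 x.
Proof. exact: (base_change_liftZ aug_classZ). Qed.

(** The preimage is the class of [1 (x) (g - 1)], since the class of the identity is zero. *)
Lemma alexander_to_H1_onto (g : G) :
  exists x, alexander_to_H1 x = bar_class K g.
Proof.
have hg : (<< g >> - << 1%g >> : grpring int G) \in @aug_pred int G.
  by rewrite inE raddfB /= !augU subrr.
exists (quot_pi _ << (AugMod hg : N) >>).
rewrite [LHS](base_change_liftU aug_classZ) /aug_class /=.
by rewrite [LHS]raddfB /= !gr_classU !scale1r bar_class1 subr0.
Qed.

End AlexanderHomology.

(** * The rank at [1] of a presentation matrix *)

Lemma mxrank_mxsub (K : fieldType) (m s m' s' : nat) (f : 'I_m' -> 'I_m)
    (g : 'I_s' -> 'I_s) (A : 'M[K]_(m, s)) :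
  (\rank (mxsub f g A) <= \rank A)%N.
Proof.
have rowsub_le p q r (h : 'I_q -> 'I_p) (B : 'M[K]_(p, r)) :
    (\rank (rowsub h B) <= \rank B)%N.
  apply/mxrankS/row_subP => i; rewrite (_ : row i _ = row (h i) B) ?row_sub //.
  by apply/rowP => j; rewrite !mxE.
rewrite (_ : mxsub f g A = rowsub f (rowsub g A^T)^T); last first.
  by apply/matrixP => i j; rewrite !mxE.
by apply: leq_trans (rowsub_le _ _ _ _ _) _; rewrite mxrank_tr
   -[X in (_ <= X)%N]mxrank_tr.
Qed.

Section AlexanderRank.
Variables (G : groupType) (K : fieldType).

(** Every 1-chain is a [K]-combination of group elements, so a family spans as soon as it reaches
    their classes. *)
Lemma bar_class_span (k : nat) (h : 'I_k -> H1 G K) :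
  (forall g, exists c : 'I_k -> K, bar_class K g = \sum_i c i *: h i) ->
  forall w, exists c : 'I_k -> K, w = \sum_i c i *: h i.
Proof.
move=> hh w; have [r ->] := quot_pi_surj w.
elim/gr_ind: r => [|x y [c1 E1] [c2 E2]|a g].
- exists (fun=> 0); rewrite [LHS]raddf0 big1 // => i _.
  by rewrite scale0r.
- exists (fun i => c1 i + c2 i); rewrite [LHS]raddfD /= E1 E2 -big_split.
  by apply: eq_bigr => i _; rewrite scalerDl.
have [c E] := hh g; exists (fun i => a * c i).
have -> : << a *g g >> = a *: << g >> :> {malg K[G]}.
  by apply/monalg.malgP => h'; rewrite monalg.mcoeffZ !monalg.mcoeffU mulrnAr mulr1.
have -> : quot_pi (@bar_boundaries G K) (a *: << g >>) = a *: bar_class K g.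
  exact: linearZ.
rewrite E scaler_sumr.
by apply: eq_bigr => i _; rewrite scalerA.
Qed.

(* The composite [Lambda^m -> A_G -> H_1(G, K)] factors through [K^m], onto
   [H_1(G, K)], and kills the columns of [P]. *)
Lemma alexander_rank (np m s : nat) (P : 'M[Lambda G]_(m, s)) :
  is_b1 G K np -> presents (alexander_module G) P ->
  (\rank (map_mx (@augK (Gabf G) K) P) + np <= m)%N.
Proof.
case=> b bP [phi [phi_surj phi_ker]].
pose h (i : 'I_m) := alexander_to_H1 K (phi (delta_mx i 0)).
have phiE v : alexander_to_H1 K (phi v) = \sum_i augK K (v i 0) *: h i.
  rewrite {1}[v]matrix_sum_delta linear_sum raddf_sum; apply: eq_bigr => i _.
  by rewrite big_ord1 linearZ; apply: alexander_to_H1Z.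
have h_span w : exists c : 'I_m -> K, w = \sum_i c i *: h i.
  apply: bar_class_span w => g; have [x <-] := alexander_to_H1_onto K g.
  by have [v <-] := phi_surj x; exists (fun i => augK K (v i 0)).
(* [C] expresses the generators [h] in the basis [b]; [D] below expresses [b] in the generators
   [h]. *)
have [C CP] := choice (fun i => let: ex_intro c (conj E _) := bP (h i) in
  ex_intro (fun c : 'rV_np => h i = \sum_j c 0 j *: b j) c E).
have [D DP] := choice (fun j => h_span (b j)).
pose Cm := \matrix_(i, j) C i 0 j; pose Dm := \matrix_(j, i) D j i.
have sumE (c : 'I_m -> K) :
    \sum_i c i *: h i = \sum_j ((\row_i c i) *m Cm) 0 j *: b j.
  under eq_bigr do rewrite CP scaler_sumr.
  rewrite exchange_big; apply: eq_bigr => j _; rewrite mxE scaler_suml.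
  by apply: eq_bigr => i _; rewrite !mxE scalerA.
(* Expanding [b j] through [h] and back gives coordinates of [b j] in [b]; by uniqueness they are
   those of the identity. *)
have DC : Dm *m Cm = 1%:M.
  apply/row_matrixP => j; have [c [cE c_uniq]] := bP (b j).
  rewrite row1 -[RHS]c_uniq; last first.
    rewrite (bigD1 j) //= big1 ?addr0 ?mxE ?eqxx ?scale1r // => i ij.
    by rewrite mxE (negbTE ij) andbF scale0r.
  rewrite -[LHS]c_uniq // {1}(DP j) sumE; apply: eq_bigr => l _.
  by rewrite row_mul; congr ((_ *m _) 0 l *: _); apply/rowP => i; rewrite !mxE.
have PC : (map_mx (@augK (Gabf G) K) P)^T *m Cm = 0.
  apply/row_matrixP => j; rewrite row0; have [c [_ c_uniq]] := bP 0.
  rewrite -[RHS]c_uniq; last by rewrite big1 // => i _; rewrite mxE scale0r.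
  rewrite -[LHS]c_uniq //.
  transitivity (alexander_to_H1 K (phi (col j P))).
    have /phi_ker -> : exists w, col j P = P *m w.
      by exists (delta_mx j 0); rewrite -colE.
    exact/esym/raddf0.
  rewrite phiE sumE; apply: eq_bigr => l _.
  by rewrite row_mul; congr ((_ *m _) 0 l *: _); apply/rowP => i; rewrite !mxE.
(* A zero product with inner dimension [m] bounds the sum of the two ranks by [m], and the left
   inverse [Dm] gives [Cm] rank [np]. *)
have := mulmx0_rank_max PC; rewrite mxrank_tr.
suff -> : \rank Cm = np by [].
by apply/eqP/row_fullP; exists Dm.
Qed.

End AlexanderRank.

(** The elements where [chi] is [1] are closed under products and inverses, and every [g] is a
    product of integer powers of the [t i]. *)
Lemma Zbasis_character (H : groupType) (R : unitRingType) (n : nat)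
    (t : 'I_n -> H) (chi : H -> R) :
  is_Zbasis t -> chi 1%g = 1 ->
  (forall x y, chi (x * y)%g = chi x * chi y) ->
  (forall i, chi (t i) = 1) -> forall g, chi g = 1.
Proof.
move=> t_basis chi1 chiM chit g.
have chiV x : chi x = 1 -> chi x^-1%g = 1.
  by move=> cx; have := chiM x^-1%g x; rewrite mulVg chi1 cx mulr1.
have chiX x k : chi x = 1 -> chi (x ^+ k)%g = 1.
  by move=> cx; elim: k => [|k IH]; rewrite ?expg0 // expgS chiM cx mul1r.
have [a [-> _]] := t_basis g.
apply: (big_ind (fun x => chi x = 1)) => //.
  by move=> x y; rewrite chiM => -> ->; rewrite mulr1.
by move=> i _; case: (a i) => k /=; rewrite ?chiV // chiX.
Qed.

(** * The Magnus expansion and the order of the Alexander ideal *)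

Section Magnus.
Variables (G : groupType) (K : fieldType) (n : nat) (t : 'I_n -> Gabf G).
Variable e : {rmorphism Lambda G -> pseries n K}.
Hypotheses (t_basis : is_Zbasis t) (e_magnus : is_magnus t e).

Lemma magnusM (g h : Gabf G) : e << (g * h)%g >> = e << g >> * e << h >>.
Proof.
rewrite -rmorphM; congr (e _).
by rewrite [RHS]gr_mulUU mulr1.
Qed.

Lemma magnus1 : e << 1%g >> = 1.
Proof. exact: rmorph1. Qed.

Lemma const_coef_magnus_grp (g : Gabf G) : const_coef (e << g >>) = 1.
Proof.
pose chi g := const_coef (e << g >>).
apply: (Zbasis_character (chi := chi) t_basis) => [|x y|i].
- exact: etrans (congr1 _ magnus1) (const_coef1 _ _).
- exact: etrans (congr1 _ (magnusM x y)) (const_coefM _ _).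
rewrite /chi e_magnus const_coefD const_coef1 /const_coef /=.
by rewrite eq_sym mnm1_eq0 addr0.
Qed.

(** Each [1 + x_i] has constant term [1], hence so does the image of every group element; additivity
    does the rest. This identifies the constant part of a minor with its value at [1]. *)
Lemma const_coef_magnus (x : Lambda G) : const_coef (e x) = augK K x.
Proof.
elim/gr_ind: x => [|x y hx hy|a g].
- by rewrite (raddf0 e) [RHS]raddf0.
- by rewrite (raddfD e) const_coefD hx hy; apply/esym/raddfD.
have -> : << a *g g >> = << g >> *~ a :> Lambda G.
  by rewrite -[in LHS](intz a) [LHS](raddfMz (monalg.mkmalgU g)).
rewrite (raddfMz e) [LHS]raddfMz [RHS]raddfMz; congr (_ *~ a).
by apply: etrans (const_coef_magnus_grp g) _; rewrite [RHS]augKU.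
Qed.

(** The [K]-linear extension of the Magnus expansion to the group algebra over [K], in which the
    almost principal condition is stated. *)
Definition magnusK : {malg K[Gabf G]} -> pseries n K :=
  monalg.mmap (@ps_const n K) (fun g : Gabf G => e << g >>).

Lemma magnusKU a g : magnusK << a *g g >> = ps_const n a * e << g >>.
Proof. exact: monalg.mmapU. Qed.

Lemma magnusKD x y : magnusK (x + y) = magnusK x + magnusK y.
Proof. exact: raddfD. Qed.

Lemma magnusK0 : magnusK 0 = 0.
Proof. exact: raddf0. Qed.

Lemma magnusKM (x y : LambdaK G K) : magnusK (x * y) = magnusK x * magnusK y.
Proof.
elim/gr_ind: x => [|x x' hx hx'|a g].
- by rewrite mul0r magnusK0 mul0r.
- rewrite mulrDl magnusKD (magnusKD x) [RHS]mulrDl; exact: (congr2 _ hx hx').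
elim/gr_ind: y => [|y y' hy hy'|b h].
- by rewrite mulr0 magnusK0 mulr0.
- rewrite mulrDr magnusKD (magnusKD y) [RHS]mulrDr; exact: (congr2 _ hy hy').
apply: etrans (congr1 magnusK (gr_mulUU a b g h)) _.
apply: etrans (magnusKU (a * b) (g * h)%g) _.
apply: etrans (congr2 *%R (rmorphM (@ps_const n K) a b) (magnusM g h)) _.
apply: etrans (mulrACA _ _ _ _) _.
exact/esym/(congr2 *%R (magnusKU a g) (magnusKU b h)).
Qed.

Lemma magnus_scale (a : int) (g : Gabf G) :
  e << a *g g >> = ps_const n a%:~R * e << g >>.
Proof.
have -> : << a *g g >> = << g >> *~ a :> Lambda G.
  by rewrite -[in LHS](intz a) [LHS](raddfMz (monalg.mkmalgU g)).
by rewrite (raddfMz e) (rmorph_int (@ps_const n K)) mulrzl.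
Qed.

Lemma magnusK_to_LambdaK (x : Lambda G) : magnusK (to_LambdaK K x) = e x.
Proof.
have toD (y z : Lambda G) : to_LambdaK K (y + z) = to_LambdaK K y + to_LambdaK K z.
  exact: (raddfD (gr_map (intr : int -> K) (@idfun (Gabf G)))).
have to0 : to_LambdaK K (0 : Lambda G) = 0.
  exact: (raddf0 (gr_map (intr : int -> K) (@idfun (Gabf G)))).
elim/gr_ind: x => [|x y hx hy|a g].
- by rewrite to0 magnusK0 (raddf0 e).
- by rewrite toD magnusKD (raddfD e); exact: (congr2 _ hx hy).
apply: etrans (etrans (magnusKU _ g) (esym (magnus_scale a g))).
exact: (congr1 magnusK (gr_mapU (intr : int -> K) (@idfun (Gabf G)) a g)).
Qed.

Lemma magnusK_ideal_gen (S : set (LambdaK G K)) k :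
  (forall x, S x -> ord_ge k (magnusK x)) ->
  forall x, ideal_gen S x -> ord_ge k (magnusK x).
Proof.
move=> hS _ [m [a [s [Ss ->]]]].
rewrite (big_morph magnusK magnusKD magnusK0); apply: ord_ge_sum => i _.
by rewrite [magnusK _](magnusKM (a i) (s i)); apply/ord_geMl/hS.
Qed.

(** A minor of size [m - 1] has constant part of rank at most [m - np], so by [ord_ge_det] its order
    is at least [(m - 1) - (m - np) = np - 1]. *)
Lemma ord_ge_alexander_ideal np x : is_b1 G K np ->
  alexander_ideal (G := G) x -> ord_ge (np - 1) (e x).
Proof.
move=> b1K [m [s [P [PA [k [a [y [hy ->]]]]]]]].
have rkP := alexander_rank b1K PA.
rewrite (raddf_sum e); apply: ord_ge_sum => i _.
rewrite [X in ord_ge _ X](rmorphM e (a i) (y i)).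
apply: ord_geMl; have [f [g [_ _ ->]]] := hy i.
rewrite -(det_map_mx e); have D := @ord_ge_det n K _ (map_mx e (mxsub f g P)).
apply: (@ord_geW _ _ _ _ _ _ D).
have -> : map_mx (@const_coef n K) (map_mx e (mxsub f g P)) =
    mxsub f g (map_mx (@augK (Gabf G) K) P).
  by apply/matrixP => i1 j1; rewrite !mxE; apply: const_coef_magnus.
have := mxrank_mxsub f g (map_mx (@augK (Gabf G) K) P).
by move: rkP; lia.
Qed.

End Magnus.

Theorem proposition3p11 (G : groupType) (n : nat) (K : fieldType) (p np d : nat)
    (t : 'I_n -> Gabf G) (Delta : Lambda G)
    (e : {rmorphism Lambda G -> pseries n K})
    (G_fp : finitely_presented G)
    (b1Q : is_b1 G rat n) (n_gt0 : (0 < n)%N)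
    (charK : has_char K p) (b1K : is_b1 G K np)
    (t_basis : is_Zbasis t) (e_magnus : is_magnus t e)
    (DeltaP : is_alexander_poly Delta)
    (almost : almost_principal K d Delta)
    (np_gt : (d + 1 < np)%N) :
  ideal_exp (ps_max n K) (np - d - 1) (e Delta) /\
  (aug Delta)%:~R = 0 :> K.
Proof.
(* The bound [np - d - 1] is positive, so it also makes the constant coefficient, which is the value
   at [1], vanish. *)
suff Delta_ord : ord_ge (np - d - 1) (e Delta).
  split; first exact: ord_ge_ideal_exp.
  rewrite -[LHS](const_coef_magnus t_basis e_magnus).
  by apply: Delta_ord; rewrite mdeg0; lia.
pose t0 : Gabf G := t (Ordinal n_gt0).
(* [u] is [t_1 - 1]: it lies in the augmentation ideal and expands to the single variable [x_1],
   whose powers can be cancelled with exact control of the order. *)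
pose u : LambdaK G K := << t0 >> - << 1%g >>.
have u_aug : aug u = 0 by rewrite [LHS]raddfB /= !augU subrr.
have eu : magnusK e u = ps_var (Ordinal n_gt0).
  rewrite [LHS]raddfB /=.
  apply: etrans (congr2 (fun f g => f - g) (magnusKU e 1 t0) (magnusKU e 1 1%g)) _.
  by rewrite rmorph1 !mul1r e_magnus (magnus1 e) addrC addKr.
have uX k : ideal_exp [set x : LambdaK G K | aug x = 0] k (u ^+ k).
  elim: k => [//|k IH]; exists 1%N, (fun=> 1), (fun=> u ^+ k.+1).
  split=> [_|]; last by rewrite big_ord1 scale1r.
  by exists u, (u ^+ k); rewrite exprS.
have Delta_gen : ideal_gen [set to_LambdaK K Delta] (to_LambdaK K Delta).
  by exists 1%N, (fun=> 1), (fun=> to_LambdaK K Delta); rewrite big_ord1 scale1r.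
have Delta_almost : ideal_gen (to_LambdaK K @` alexander_ideal (G := G))
    (u ^+ d * to_LambdaK K Delta).
  apply: almost; exists 1%N, (fun=> 1), (fun=> u ^+ d * to_LambdaK K Delta).
  split=> [_|]; last by rewrite big_ord1 scale1r.
  by exists (u ^+ d), (to_LambdaK K Delta).
have euX k x : magnusK e (u ^+ k * x) = ps_var (Ordinal n_gt0) ^+ k * magnusK e x.
  elim: k => [|k IH]; first by rewrite !expr0 !mul1r.
  rewrite !exprS -!mulrA.
  exact: etrans (magnusKM e u _) (congr2 *%R eu IH).
have := @magnusK_ideal_gen _ _ _ e _ (np - 1) _ _ Delta_almost.
(* The image of [u ^+ d] times [Delta] has order at least [np - 1]; cancelling [x_1 ^+ d] leaves
   [np - 1 - d]. *)
rewrite euX magnusK_to_LambdaK => /(_ _)/ord_ge_varX; rewrite subnAC; apply.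
move=> _ [x xE <-]; rewrite magnusK_to_LambdaK.
exact: (ord_ge_alexander_ideal t_basis e_magnus b1K).
Qed.
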